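(* There is a two-sided brace $(A, +, \circ)$ such that its multiplicative group $(A, \circ)$ contains a non-abelian free subgroup.
   Context: A left brace is a triple $(A, +, \circ)$ where $(A,+)$ is an abelian group, $(A,\circ)$ is a group, and $a \circ (b + c) = (a \circ b) - a + (a \circ c)$ for all $a,b,c \in A$. It is a two-sided brace if in addition $(a + b) \circ c = (a \circ c) - c + (b \circ c)$ for all $a,b,c \in A$. *)

(* Defs.v *)
From HB Require Import structures.
From mathcomp Require Import all_boot all_order all_algebra.

Set Implicit Arguments.
Unset Strict Implicit.
Unset Printing Implicit Defensive.

Import GRing.Theory.
Local Open Scope ring_scope.

Declare Scope brace_scope.
Delimit Scope brace_scope with brace.

(* The circle operation of a brace is the product of its groupType structure:
   it lives in group_scope, whereas addition lives in ring_scope. *)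
Notation "a ∘ b" := (a * b)%g (at level 40, left associativity) : brace_scope.
Local Open Scope brace_scope.

HB.mixin Record isLeftBrace A of GRing.Zmodule A & Group A := {
  braceDr : forall a b c : A, a ∘ (b + c) = a ∘ b - a + a ∘ c
}.

#[short(type="leftBraceType")]
HB.structure Definition LeftBrace :=
  {A of isLeftBrace A & GRing.Zmodule A & Group A}.

HB.mixin Record LeftBrace_isTwoSided A of LeftBrace A := {
  braceDl : forall a b c : A, (a + b) ∘ c = a ∘ c - c + b ∘ c
}.

#[short(type="twoSidedBraceType")]
HB.structure Definition TwoSidedBrace :=
  {A of LeftBrace_isTwoSided A & LeftBrace A}.

(* fingroup only treats subgroups of finite groups, so subgroups of an
   arbitrary groupType are represented by their membership predicates. *)
Section Subgroups.
Variable G : groupType.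
Implicit Types (X H : G -> Prop) (l : G * bool) (w : seq (G * bool)).

Definition is_subgroup H : Prop :=
  [/\ H 1%g, forall x y, H x -> H y -> H (x * y)%g
    & forall x, H x -> H x^-1%g].

Definition nonabelian H : Prop :=
  exists x y, [/\ H x, H y & (x * y)%g <> (y * x)%g].

(* A letter (x, true) stands for x, and (x, false) for the inverse of x. *)
Definition letter_val l : G := if l.2 then l.1 else l.1^-1%g.

Definition word_val w : G := (\prod_(l <- w) letter_val l)%g.

Definition cancelling l1 l2 : bool := (l1.1 == l2.1) && (l1.2 != l2.2).

Definition reduced w : bool := sorted (fun l1 l2 => ~~ cancelling l1 l2) w.

Definition word_over X w : Prop := forall l, l \in w -> X l.1.

(* H is freely generated by X: X is contained in H, and each element of H is
   the value of exactly one reduced word over X. *)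
Definition free_basis X H : Prop :=
  (forall x, X x -> H x) /\
  (forall h, H h ->
     exists! w, [/\ word_over X w, reduced w & word_val w = h]).

Definition is_free_subgroup H : Prop :=
  is_subgroup H /\ exists X, free_basis X H.

End Subgroups.

(* Main.v *)
(* Let R be the localisation of Z at 2 and S = M_2(R). Since det (1 + 4a) lies in
   1 + 4R, every 1 + 4a with a in S is invertible, so the operation
   a ∘ b = a + b + 4ab, for which a |-> 1 + 4a is multiplicative, makes S a
   two-sided brace (isomorphic to the radical ring 4S). Its multiplicative group
   contains the elements corresponding to the transvections [[1,4],[0,1]] and
   [[1,0],[4,1]], which generate a free group by ping-pong on the plane, with
   base point (1, 1): the value at (1, 1) of a nonempty reduced word satisfies
   |v2| < |v1| or |v1| < |v2| according to its first generator, and the sign of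
   v1 * v2 is the sign of the exponent of that generator. *)
Require Import Defs.
From HB Require Import structures.
From mathcomp Require Import all_boot all_order all_algebra.
From mathcomp Require Import zify ring lra.

Set Implicit Arguments.
Unset Strict Implicit.
Unset Printing Implicit Defensive.

Import Order.TTheory GRing.Theory Num.Theory.
Local Open Scope ring_scope.

(** * The localisation of Z at 2, as a subring of the rationals *)

Definition odd_den : {pred rat} := fun q => odd `|denq q|.

(** The reduced denominator is coprime to the numerator, so it divides every integer [d] with
    [q * d] integral, and divisors of odd numbers are odd. *)
Lemma odd_denP (q : rat) :
  reflect (exists2 d : int, odd `|d| & q * d%:~R \is a Num.int) (q \in odd_den).
Proof.
apply: (iffP idP) => [q_odd | [d d_odd /intrP[m qd]]].
  by exists (denq q) => //; rewrite -numqE intr_int.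
have /eqP : numq q * d = m * denq q.
  by apply: (@intr_inj rat); rewrite !rmorphM /= -qd numqE mulrAC.
have : (denq q %| numq q * d)%Z -> odd `|denq q|.
  rewrite dvdzE abszM Gauss_dvdr; last by rewrite coprime_sym coprime_num_den.
  by move/dvdn_odd; apply.
by move=> den_odd /eqP eq_q; apply: den_odd; rewrite eq_q dvdz_mull.
Qed.

Fact odd_den_subring : subring_closed odd_den.
Proof.
split=> [|p q /odd_denP[d d_odd pd] /odd_denP[e e_odd qe]
         |p q /odd_denP[d d_odd pd] /odd_denP[e e_odd qe]]; first by [].
- apply/odd_denP; exists (d * e); first by rewrite abszM oddM d_odd e_odd.
  rewrite intrM (_ : _ * _ = p * d%:~R * e%:~R - q * e%:~R * d%:~R); last ring.
  by rewrite rpredB // rpredM ?intr_int.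
- apply/odd_denP; exists (d * e); first by rewrite abszM oddM d_odd e_odd.
  by rewrite rmorphM /= mulrACA rpredM.
Qed.
HB.instance Definition _ :=
  GRing.isSubringClosed.Build rat odd_den odd_den_subring.

Definition rat_loc2 := {q : rat | q \in odd_den}.
HB.instance Definition _ := SubType.on rat_loc2.
HB.instance Definition _ := Choice.on rat_loc2.
HB.instance Definition _ := [SubChoice_isSubComNzRing of rat_loc2 by <:].

(** [insubd] falls back to 0 when the rational inverse has even denominator; this never happens for
    z = 1 + 4x. *)
Definition loc2_inv (z : rat_loc2) : rat_loc2 := insubd 0 (val z)^-1.

(** If x = m/d with d odd, then 1 + 4x = (d + 4m)/d has odd numerator, so d/(d + 4m) stays in the
    ring. *)
Lemma loc2_1p4_unit (x : rat_loc2) : (1 + x *+ 4) * loc2_inv (1 + x *+ 4) = 1.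
Proof.
apply: val_inj; rewrite rmorphM /=.
have /odd_denP[d d_odd /intrP[m xd]] := valP x.
have val4 : val (1 + x *+ 4) = 1 + val x *+ 4 by rewrite rmorphD rmorph1 rmorphMn.
have d0 : d != 0 by apply: contraTneq d_odd => ->.
have n0 : d + m *+ 4 != 0 by apply: contraTneq d_odd => /eqP; lia.
have eqx : (1 + val x *+ 4) * d%:~R = (d + m *+ 4)%:~R.
  by rewrite rmorphD rmorphMn /= -xd mulrDl mul1r mulrnAl.
have x0 : 1 + val x *+ 4 != 0.
  apply: contraNneq n0 => x0; move: eqx; rewrite x0 mul0r => /esym/eqP.
  by rewrite intr_eq0.
rewrite /loc2_inv insubdK val4 ?divff //.
apply/odd_denP; exists (d + m *+ 4); first lia.
by rewrite -eqx mulKf // intr_int.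
Qed.

(** * The circle operation a + b + n a b on a ring *)

Section CircleOperation.
Variables (S : pzRingType) (n : nat).
Implicit Types a b c : S.

Definition circ a b := a + b + (a * b) *+ n.

Lemma circA : associative circ.
Proof.
move=> a b c; rewrite /circ !(mulrDl, mulrDr, mulrnAl, mulrnAr, mulrnDl, mulrA).
rewrite !addrA; congr (_ + _); rewrite -!addrA; do 2 congr (_ + _).
by rewrite [RHS]addrCA; congr (_ + _); rewrite addrC -addrA.
Qed.

Lemma circ0x : left_id 0 circ.
Proof. by move=> a; rewrite /circ mul0r mul0rn addr0 add0r. Qed.

Lemma circx0 : right_id 0 circ.
Proof. by move=> a; rewrite /circ mulr0 mul0rn !addr0. Qed.

Lemma circDr a b c : circ a (b + c) = circ a b - a + circ a c.
Proof.
by rewrite /circ mulrDr mulrnDl -!addrA; do 2 congr (_ + _); rewrite addKr addrCA.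
Qed.

Lemma circDl a b c : circ (a + b) c = circ a c - c + circ b c.
Proof.
rewrite /circ mulrDl mulrnDl -!addrA; congr (_ + _).
by rewrite [RHS]addrCA addNKr [RHS]addrCA; congr (_ + _); rewrite addrCA.
Qed.

End CircleOperation.

(** * The two-sided brace of square matrices over a commutative ring *)

Section AdjointMatrixBrace.
Variables (R : comNzRingType) (m n : nat) (inv : R -> R).
Hypothesis invP : forall x, (1 + x *+ n) * inv (1 + x *+ n) = 1.
Implicit Type a : 'M[R]_m.+1.

(** det (1 + X a) is a polynomial in X with constant term 1, hence of the form 1 + q X; evaluate it
    at n. *)
Lemma det_1Dmuln a : exists x, \det (1 + a *+ n) = 1 + x *+ n.
Proof.
pose p := \det (1 + 'X *: map_mx polyC a).
have det_horner z : p.[z] = \det (1 + z *: a).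
  rewrite -horner_evalE -det_map_mx; congr (\det _).
  by apply/matrixP => i j; rewrite !mxE -[LHS]/(_.[z]) hornerD hornerMn !hornerE.
have /factor_theorem[q def_p] : root (p - 1) 0.
  by rewrite /root !hornerE det_horner scale0r addr0 det1 subrr.
exists q.[n%:R]; rewrite -scaler_nat -det_horner -[p](subrK 1) def_p !hornerE.
by rewrite addrC subr0 mulr_natr.
Qed.

(* From (1 + n a)^-1 = 1 + n (circ_inv a), by Cramer's rule. *)
Definition circ_inv a := - (inv (\det (1 + a *+ n)) *: (a * \adj (1 + a *+ n))).

Lemma circxV : right_inverse 0 circ_inv (@circ _ n : 'M[R]_m.+1 -> _).
Proof.
move=> a; rewrite /circ /circ_inv mulrN mulNrn -addrA -opprD.
rewrite -scalerAr scalerMnr -scalerDr mulrA.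
(* Factoring out a on the left leaves a (1 + n a) adj (1 + n a), and a matrix times its adjugate is
   its determinant. *)
have -> : a * \adj (1 + a *+ n) + (a * a * \adj (1 + a *+ n)) *+ n
          = \det (1 + a *+ n) *: a.
  rewrite -mulrnAl -mulrDl -mulrnAr -[X in (X + _) * _]mulr1 -mulrDr -mulrA.
  by rewrite -[_ * \adj _]/(_ *m _) mul_mx_adj -[LHS]/(_ *m _) mul_mx_scalar.
by have [x ->] := det_1Dmuln a; rewrite scalerA mulrC invP scale1r subrr.
Qed.

(** In a monoid where every element has a right inverse, right inverses are also left inverses. *)
Lemma circVx : left_inverse 0 circ_inv (@circ _ n : 'M[R]_m.+1 -> _).
Proof.
move=> a; rewrite -[LHS](circx0 n) -[X in circ _ _ X](circxV (circ_inv a)).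
by rewrite circA -[X in circ _ X _]circA circxV circx0 circxV.
Qed.

End AdjointMatrixBrace.

(* An alias, so that the circle product does not clash with the matrix product. *)
Definition matrix_brace (R : comNzRingType) m n (inv : R -> R)
  (invP : forall x, (1 + x *+ n) * inv (1 + x *+ n) = 1) := 'M[R]_m.+1.

Section MatrixBraceInstances.
Variables (R : comNzRingType) (m n : nat) (inv : R -> R).
Hypothesis invP : forall x, (1 + x *+ n) * inv (1 + x *+ n) = 1.
Local Notation A := (matrix_brace m invP).

HB.instance Definition _ := GRing.Zmodule.on A.
HB.instance Definition _ := isGroup.Build A
  (@circA _ n) (@circ0x _ n) (@circx0 _ n) (circVx invP) (circxV invP).
HB.instance Definition _ := isLeftBrace.Build A (@circDr _ n).
HB.instance Definition _ := LeftBrace_isTwoSided.Build A (@circDl _ n).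

(** An off-diagonal matrix unit squares to zero, so the quadratic term of its circle product with
    its opposite vanishes. *)
Lemma delta_mxVg i j :
  i != j -> ((delta_mx i j : A)^-1)%g = - (delta_mx i j : A).
Proof.
move=> ij; apply: (mulgI (delta_mx i j : A)); rewrite mulgV.
rewrite -[RHS]/(circ n (delta_mx i j) (- delta_mx i j)) /circ subrr add0r mulrN.
by rewrite [X in (- X) *+ _]mul_delta_mx_0 1?eq_sym // oppr0 mul0rn.
Qed.

End MatrixBraceInstances.

(** * Words and the subgroup generated by a set *)

Section WordSubgroup.
Variables (G : groupType) (X : G -> Prop).
Implicit Types (l : G * bool) (w : seq (G * bool)).

Definition word_subgroup (h : G) := exists2 w, word_over X w & word_val w = h.

Lemma word_over_cons l w : word_over X (l :: w) <-> X l.1 /\ word_over X w.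
Proof.
split=> [Xlw | [Xl Xw] k]; last by rewrite inE => /orP[/eqP-> | /Xw].
by split=> [|k kw]; apply: Xlw; rewrite inE ?eqxx ?kw ?orbT.
Qed.

Lemma word_val_cons l w : word_val (l :: w) = (letter_val l * word_val w)%g.
Proof. by rewrite /word_val big_cons. Qed.

Lemma is_subgroup_word : is_subgroup word_subgroup.
Proof.
split=> [|_ _ [u Xu <-] [v Xv <-] | _ [w Xw <-]].
- by exists [::]; rewrite // /word_val big_nil.
- exists (u ++ v); last by rewrite /word_val big_cat.
  by move=> l; rewrite mem_cat => /orP[/Xu | /Xv].
- elim: w Xw => [|l w IHw] Xw.
    by exists [::]; rewrite // /word_val big_nil invg1.
  have [Xl /IHw[u Xu u_val]] := (word_over_cons _ _).1 Xw.
  exists (rcons u (l.1, ~~ l.2)).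
    by move=> k; rewrite mem_rcons inE => /orP[/eqP-> | /Xu].
  rewrite word_val_cons invgM -u_val /word_val big_rcons /=; congr (_ * _)%g.
  by case: l {Xw Xl} => x [] //=; rewrite /letter_val /= invgK.
Qed.

Lemma letter_val_cancelling l k :
  cancelling l k -> (letter_val l * letter_val k)%g = 1%g.
Proof.
case: l k => [x b] [y c] /andP[/eqP/= <-]; rewrite /letter_val.
by case: b c => [] [] //= _; rewrite ?mulgV ?mulVg.
Qed.

(** A letter put in front of a reduced word either leaves it reduced or cancels against its first
    letter, and the tail is again reduced. *)
Lemma reduced_word_exists w :
  word_over X w -> exists u, [/\ word_over X u, reduced u & word_val u = word_val w].
Proof.
elim: w => [|l w IHw] Xw; first by exists [::].
have [Xl /IHw[[|k u] [Xu u_red u_val]]] := (word_over_cons _ _).1 Xw.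
  exists [:: l]; rewrite !word_val_cons u_val; split=> //; exact/word_over_cons.
have [lk | lk] := boolP (cancelling l k); last first.
  exists [:: l, k & u]; rewrite word_val_cons u_val word_val_cons; split=> //.
    exact/word_over_cons.
  by rewrite /reduced /= lk.
exists u; split; first by have [] := (word_over_cons _ _).1 Xu.
  exact: path_sorted u_red.
by rewrite word_val_cons -u_val word_val_cons mulgA letter_val_cancelling ?mul1g.
Qed.

Lemma free_basis_word :
  (forall u v, word_over X u -> reduced u -> word_over X v -> reduced v ->
     word_val u = word_val v -> u = v) ->
  free_basis X word_subgroup.
Proof.
move=> word_inj; split=> [x Xx | _ [w /reduced_word_exists[u [Xu u_red u_val]] <-]].
  exists [:: (x, true)]; first by move=> l; rewrite inE => /eqP->.
  by rewrite /word_val big_seq1.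
by exists u; split=> // v [Xv v_red v_val]; apply: word_inj; rewrite ?u_val.
Qed.

(** If x and y commuted, the distinct reduced words xy and yx would have the same value. *)
Lemma free_basis_nonabelian (H : G -> Prop) x y :
  is_subgroup H -> free_basis X H -> X x -> X y -> x <> y -> nonabelian H.
Proof.
move=> [_ HM _] [XH unique_word] Xx Xy xy; exists x, y; split; try exact: XH.
move=> xyC; have [w [_ w_uniq]] := unique_word _ (HM _ _ (XH _ Xx) (XH _ Xy)).
have xy_w a b : X a -> X b -> (a * b = x * y)%g -> w = [:: (a, true); (b, true)].
  move=> Xa Xb ab; apply: w_uniq; split.
  - by move=> l; rewrite !inE => /orP[] /eqP->.
  - by rewrite /reduced /= /cancelling andbF.
  - by rewrite !word_val_cons /word_val big_nil mulg1.
by move: (xy_w x y Xx Xy erefl); rewrite (xy_w y x) // => -[].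
Qed.

End WordSubgroup.

(** * The ping-pong criterion for freeness *)

Section PingPong.
Variables (G : groupType) (T : Type) (act : G -> T -> T) (p : T).
Variables (X : G -> Prop) (D : G * bool -> T -> Prop).
Hypothesis act1 : forall v, act 1%g v = v.
Hypothesis actM : forall g h v, act (g * h)%g v = act g (act h v).
Hypothesis D_base : forall l, X l.1 -> D l (act (letter_val l) p).
Hypothesis D_step : forall l k v, X l.1 -> X k.1 -> ~~ cancelling l k ->
  D k v -> D l (act (letter_val l) v).
Hypothesis D_disjoint : forall l k v, X l.1 -> X k.1 -> D l v -> D k v -> l = k.
Hypothesis D_out : forall l, X l.1 -> ~ D l p.

(** [D l] is the region into which reduced words with first letter [l] send the base point [p];
    induct from the last letter, which acts first. *)
Lemma ping_pong_word l w :
  word_over X (l :: w) -> reduced (l :: w) -> D l (act (word_val (l :: w)) p).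
Proof.
elim: w l => [|k w IHw] l /word_over_cons[Xl Xw].
  by move=> _; rewrite word_val_cons /word_val big_nil mulg1; apply: D_base.
move=> /andP[lk kw_red]; rewrite word_val_cons actM.
apply: (D_step Xl _ lk); last exact: IHw.
by have [] := (word_over_cons _ _ _).1 Xw.
Qed.

(** The region containing the image of [p] determines the first letter, which is then cancelled; the
    empty word fixes [p], which lies in no region. *)
Lemma ping_pong : free_basis X (word_subgroup X).
Proof.
apply: free_basis_word => u v.
elim: u v => [|l u IHu] [|k v] // Xu u_red Xv v_red uv.
- have [Xk _] := (word_over_cons _ _ _).1 Xv; case: (D_out Xk).
  by have := ping_pong_word Xv v_red; rewrite -uv /word_val big_nil act1.
- have [Xl _] := (word_over_cons _ _ _).1 Xu; case: (D_out Xl).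
  by have := ping_pong_word Xu u_red; rewrite uv /word_val big_nil act1.
have [[Xl Xu'] [Xk Xv']] :=
  ((word_over_cons _ _ _).1 Xu, (word_over_cons _ _ _).1 Xv).
have eq_lk : l = k.
  apply: D_disjoint (ping_pong_word Xu u_red) _ => //.
  by rewrite uv; apply: ping_pong_word.
rewrite -eq_lk in uv *; congr (_ :: _); apply: IHu => //.
- exact: path_sorted u_red.
- exact: path_sorted v_red.
- by apply: (mulgI (letter_val l)); rewrite -!word_val_cons.
Qed.

End PingPong.

(** * Ping-pong for two transvections of the plane *)

Section TransvectionPingPong.
Variables (F : realFieldType) (G : groupType) (act : G -> F * F -> F * F) (x y : G).
Hypothesis act1 : forall v, act 1%g v = v.
Hypothesis actM : forall g h v, act (g * h)%g v = act g (act h v).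
Hypothesis act_x : forall b v,
  act (letter_val (x, b)) v = (v.1 + (if b then 4 else -4) * v.2, v.2).
Hypothesis act_y : forall b v,
  act (letter_val (y, b)) v = (v.1, v.2 + (if b then 4 else -4) * v.1).
Hypothesis neq_xy : x != y.

Let D (l : G * bool) (v : F * F) : bool :=
  (if l.2 then 0 < v.1 * v.2 else v.1 * v.2 < 0) &&
  (if l.1 == x then v.2 ^+ 2 < v.1 ^+ 2 else v.1 ^+ 2 < v.2 ^+ 2).

Lemma transvections_free :
  free_basis (fun z => z = x \/ z = y) (word_subgroup (fun z => z = x \/ z = y)).
Proof.
have yx : (y == x) = false by rewrite eq_sym (negPf neq_xy).
apply: (@ping_pong _ _ act (1, 1) _ D act1 actM).
(* The base point goes to (5, 1), (-3, 1), (1, 5) or (1, -3). *)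
- case=> _ b /= [->|->]; rewrite /D ?act_x ?act_y /= ?eqxx ?yx;
  by case: b; apply/andP; split; lra.
(* For different generators, 4 times the larger coordinate outweighs the smaller one; for l = k, the
   sign condition makes both summands of the changed coordinate agree in sign. *)
- case=> [_ b] [_ c] [p q] /= [->|->] [->|->];
  rewrite /D ?act_x ?act_y /cancelling /= ?eqxx ?(eq_sym x) ?yx /=;
  case: b c => [] [] //= _ /andP[pq_sgn pq_lt]; apply/andP; split; nra.
- case=> [_ b] [_ c] [p q] /= [->|->] [->|->]; rewrite /D /= ?eqxx ?yx /=;
  case: b c => [] [] //= /andP[pq_sgn pq_lt] /andP[pq_sgn' pq_lt']; exfalso; lra.
- by case=> [_ b] /= [->|->]; rewrite /D /= ?eqxx ?yx ltxx andbF.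
Qed.

End TransvectionPingPong.

(** * The brace over the localisation at 2 and its free subgroup *)

Definition loc2_brace := matrix_brace 1 loc2_1p4_unit.
HB.instance Definition _ := TwoSidedBrace.on loc2_brace.

(** The matrix 1 + 4a acting on column vectors. *)
Definition loc2_act (a : loc2_brace) (v : rat * rat) : rat * rat :=
  (v.1 + 4 * (val (a 0 0) * v.1 + val (a 0 1) * v.2),
   v.2 + 4 * (val (a 1 0) * v.1 + val (a 1 1) * v.2)).

Lemma loc2_act1 v : loc2_act 1%g v = v.
Proof.
by case: v => p q; rewrite /loc2_act !mxE !(mul0r, addr0, mulr0).
Qed.

Lemma loc2_mulE (a b : loc2_brace) i j :
  val ((a * b)%g i j) =
    val (a i j) + val (b i j)
    + (val (a i 0) * val (b 0 j) + val (a i 1) * val (b 1 j)) *+ 4.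
Proof.
rewrite -[(a * b)%g]/(circ 4 a b) /circ !mxE.
(* Puts the index 1 in the form that [big_ord_recl] produces. *)
have -> : 1 = lift ord0 ord0 :> 'I_2 by apply: val_inj.
by rewrite !big_ord_recl !big_ord0 !(rmorphD, rmorphM) /=; ring.
Qed.

Lemma loc2_actM a b v : loc2_act (a * b)%g v = loc2_act a (loc2_act b v).
Proof.
by rewrite /loc2_act !loc2_mulE /=; congr (_, _); ring.
Qed.

(** Named after 1 + 4a, which here is the transvection [[1,4],[0,1]]. *)
Definition upper4 : loc2_brace := delta_mx 0 1.
Definition lower4 : loc2_brace := delta_mx 1 0.

Lemma upper4_act b v :
  loc2_act (letter_val (upper4, b)) v = (v.1 + (if b then 4 else -4) * v.2, v.2).
Proof.
by case: b; rewrite /letter_val /= ?delta_mxVg // /loc2_act !mxE;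
  congr (_, _) => /=; ring.
Qed.

Lemma lower4_act b v :
  loc2_act (letter_val (lower4, b)) v = (v.1, v.2 + (if b then 4 else -4) * v.1).
Proof.
by case: b; rewrite /letter_val /= ?delta_mxVg // /loc2_act !mxE;
  congr (_, _) => /=; ring.
Qed.

Lemma upper4_neq_lower4 : upper4 != lower4.
Proof. by apply/eqP => /matrixP/(_ 0 1); rewrite !mxE. Qed.

Theorem proposition6p1 :
  exists (A : twoSidedBraceType) (H : A -> Prop),
    is_free_subgroup H /\ nonabelian H.
Proof.
have H_free := transvections_free loc2_act1 loc2_actM upper4_act lower4_act
  upper4_neq_lower4.
have H_sub := is_subgroup_word (fun z => z = upper4 \/ z = lower4).
exists loc2_brace, (word_subgroup (fun z => z = upper4 \/ z = lower4)).
split; first by split=> //; exists (fun z => z = upper4 \/ z = lower4).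
apply: (free_basis_nonabelian H_sub H_free) (or_introl erefl) (or_intror erefl) _.
exact/eqP/upper4_neq_lower4.
Qed.
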